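(* There exist constants $c,C>0$ such that for all sufficiently large $n$ and all $r\ge 0$, $0<\epsilon\le1$ and $R$ with $\epsilon<R$ and $c\sqrt{\log n}\le R\le\sqrt n$, with probability at least $1-1/n$ the flooding time of the stationary geometric-MEG $\mathcal{G}(n,r,R,\epsilon)$ is at most $C\left(\frac{\sqrt n}{R}+\log\log R\right)$.
   Context: $L_{n,\epsilon}=\{(i\epsilon,j\epsilon): i,j\in\mathbb{N},\ i,j\le\sqrt n/\epsilon\}$; $\Gamma(\mathbf{x})=\{\mathbf{y}\in L_{n,\epsilon}:d(\mathbf{x},\mathbf{y})\le r\}$ with $d$ Euclidean distance. Each node $i\in[n]$ has position $P_{i,t}\in L_{n,\epsilon}$ evolving independently as a Markov chain that moves from $\mathbf{x}$ to a uniform random point of $\Gamma(\mathbf{x})$. The geometric-MEG $\mathcal{G}(n,r,R,\epsilon)=\{G_t\}$ has $G_t=([n],E_t)$, $E_t=\{\{i,j\}: d(P_{i,t},P_{j,t})\le R\}$. It is stationary when the initial positions are independent with law $\pi(\mathbf{x})=|\Gamma(\mathbf{x})|/\sum_{\mathbf{y}}|\Gamma(\mathbf{y})|$. Flooding from source $s$: $I_0=\{s\}$, $I_{t+1}=I_t\cup N_t(I_t)$, where $N_t(I)$ is the set of nodes outside $I$ adjacent in $G_t$ to a node of $I$; $T(s)$ is the first $t$ with $I_t=[n]$, and the flooding time is $\max_s T(s)$. *)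

(* Defs.v *)
From Stdlib Require Import Reals List Arith ZArith.
Import ListNotations.
Open Scope R_scope.

(** Grid points are encoded by their integer indices (i,j), standing for the
    point (i*eps, j*eps) of L_{n,eps}. *)
Definition pt : Type := (nat * nat)%type.

Definition gdist (eps : R) (x y : pt) : R :=
  sqrt ((eps * INR (fst x) - eps * INR (fst y)) ^ 2
        + (eps * INR (snd x) - eps * INR (snd y)) ^ 2).

Definition Rleb (a b : R) : bool := if Rle_dec a b then true else false.

(** Largest index M = floor (sqrt n / eps): i <= sqrt n / eps  iff  i <= M. *)
Definition gridM (n : nat) (eps : R) : nat :=
  Z.to_nat (Int_part (sqrt (INR n) / eps)).

Definition grid (n : nat) (eps : R) : list pt :=
  list_prod (seq 0 (S (gridM n eps))) (seq 0 (S (gridM n eps))).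

Definition Gamma (n : nat) (eps r : R) (x : pt) : list pt :=
  filter (fun y => Rleb (gdist eps x y) r) (grid n eps).

Fixpoint Rsum (l : list R) : R :=
  match l with [] => 0 | a :: l' => a + Rsum l' end.

(** A finitely supported distribution: list of (weight, point). *)
Definition dist := list (R * pt).

(** Stationary law pi(x) = |Gamma x| / sum_y |Gamma y|. *)
Definition pi_dist (n : nat) (eps r : R) : dist :=
  let Z := Rsum (map (fun y => INR (length (Gamma n eps r y))) (grid n eps)) in
  map (fun x => (INR (length (Gamma n eps r x)) / Z, x)) (grid n eps).

Definition step_dist (n : nat) (eps r : R) (x : pt) : dist :=
  map (fun y => (/ INR (length (Gamma n eps r x)), y)) (Gamma n eps r x).

(** Expectation of g over the product of independent distributions ds
    (one coordinate per node, in order). *)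
Fixpoint Eprod (ds : list dist) (g : list pt -> R) : R :=
  match ds with
  | [] => g []
  | d :: ds' => Rsum (map (fun wx => fst wx * Eprod ds' (fun l => g (snd wx :: l))) d)
  end.

(** Nodes are 0..n-1; P : list pt gives the positions (node i at nth i P). *)
Definition adjb (Rr eps : R) (P : list pt) (i j : nat) : bool :=
  Rleb (gdist eps (nth i P (0%nat,0%nat)) (nth j P (0%nat,0%nat))) Rr.

(** Informed sets for all sources simultaneously: I s j = (j in I_t for source s).
    One flooding round in G_t (positions P):  I_{t+1} = I_t ∪ N_t(I_t). *)
Definition flood_step (n : nat) (Rr eps : R) (P : list pt)
    (I : nat -> nat -> bool) : nat -> nat -> bool :=
  fun s j => orb (I s j) (existsb (fun i => andb (I s i) (adjb Rr eps P i j)) (seq 0 n)).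

Definition all_informed (n : nat) (I : nat -> nat -> bool) : bool :=
  forallb (fun s => forallb (fun j => I s j) (seq 0 n)) (seq 0 n).

Fixpoint succ_prob (n : nat) (r Rr eps : R) (k : nat) (P : list pt)
    (I : nat -> nat -> bool) : R :=
  match k with
  | O => if all_informed n I then 1 else 0
  | S k' => Eprod (map (step_dist n eps r) P)
              (fun P' => succ_prob n r Rr eps k' P' (flood_step n Rr eps P I))
  end.

(** Probability that the flooding time max_s T(s) of the stationary
    geometric-MEG G(n,r,Rr,eps) is at most K (K a natural number):
    initial positions i.i.d. with law pi, I_0 = {s} for each source s. *)
Definition flood_prob (n : nat) (r Rr eps : R) (K : nat) : R :=
  Eprod (repeat (pi_dist n eps r) n)
        (fun P0 => succ_prob n r Rr eps K P0 (fun s j => Nat.eqb s j)).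

(* Main.v *)
(** Cut the square into cells of side about [Rr / 5], so that nodes in the same or in
    neighbouring cells are adjacent.  The stationary law is within a factor 16 of uniform;
    hence, by exponential moments and [Rr >= 400 sqrt (ln n)], each cell contains between
    [a = Rr^2 / 25600] and [b = 16 Rr^2] nodes at all times considered, outside an event
    of probability at most [1 / n].  The rest is deterministic and needs no information on
    how the nodes move between rounds.  If [A] is the set of cells meeting the informed
    set, then after one round all nodes in [A] and in its boundary are informed, and
    [|bd A|^2 >= min |A| |complement of A|].  With [u] informed and [v] uninformed nodes,
    this makes the potential [sqrt u - sqrt v], which lies in [[- sqrt n, sqrt n]],
    increase by at least a multiple of [Rr] per round until [v < a]; then every cell is
    touched, and one more round finishes. *)

From Stdlib Require Import Reals List Arith ZArith Lia Lra ClassicalEpsilon.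
Require Import Defs.
Import ListNotations.
Open Scope R_scope.

(** * Finite sums and indicator functions *)

Definition lsum {A : Type} (f : A -> R) (l : list A) : R := Rsum (map f l).

Lemma sum_le {A : Type} (f g : A -> R) (l : list A) :
  (forall x, In x l -> f x <= g x) -> lsum f l <= lsum g l.
Proof.
  induction l as [|a l IH]; intros H; unfold lsum in *; simpl; [lra|].
  apply Rplus_le_compat; [apply H; now left|].
  apply IH; intros x Hx; apply H; now right.
Qed.

Lemma sum_ext {A : Type} (f g : A -> R) (l : list A) :
  (forall x, In x l -> f x = g x) -> lsum f l = lsum g l.
Proof.
  intros H; apply Rle_antisym; apply sum_le; intros x Hx; rewrite (H x Hx); lra.
Qed.

Lemma sum_plus {A : Type} (f g : A -> R) (l : list A) :
  lsum (fun x => f x + g x) l = lsum f l + lsum g l.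
Proof. induction l as [|a l IH]; unfold lsum in *; simpl; [|rewrite IH]; lra. Qed.

Lemma sum_scal {A : Type} (c : R) (f : A -> R) (l : list A) :
  lsum (fun x => c * f x) l = c * lsum f l.
Proof. induction l as [|a l IH]; unfold lsum in *; simpl; [|rewrite IH]; lra. Qed.

Lemma sum_const {A : Type} (c : R) (l : list A) :
  lsum (fun _ => c) l = INR (length l) * c.
Proof.
  induction l as [|a l IH]; [unfold lsum; simpl; lra|].
  change (length (a :: l)) with (S (length l)); rewrite S_INR.
  unfold lsum in *; simpl; rewrite IH; lra.
Qed.

Lemma sum_nonneg {A : Type} (f : A -> R) (l : list A) :
  (forall x, In x l -> 0 <= f x) -> 0 <= lsum f l.
Proof.
  intros H; replace 0 with (lsum (fun _ : A => 0) l) by (rewrite sum_const; lra).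
  now apply sum_le.
Qed.

Lemma sum_swap {A B : Type} (f : A -> B -> R) (l : list A) (l' : list B) :
  lsum (fun x => lsum (f x) l') l = lsum (fun y => lsum (fun x => f x y) l) l'.
Proof.
  induction l as [|a l IH].
  - replace (lsum (fun y => lsum (fun x => f x y) []) l') with (lsum (fun _ : B => 0) l')
      by now apply sum_ext.
    rewrite sum_const; unfold lsum; simpl; lra.
  - change (lsum (fun x => lsum (f x) l') (a :: l))
      with (lsum (f a) l' + lsum (fun x => lsum (f x) l') l).
    rewrite IH, <- sum_plus; now apply sum_ext.
Qed.

Lemma sum_app {A : Type} (f : A -> R) (l l' : list A) :
  lsum f (l ++ l') = lsum f l + lsum f l'.
Proof. induction l as [|a l IH]; unfold lsum in *; simpl; [|rewrite IH]; lra. Qed.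

Lemma sum_map {A B : Type} (h : A -> B) (f : B -> R) (l : list A) :
  lsum f (map h l) = lsum (fun x => f (h x)) l.
Proof. unfold lsum; now rewrite map_map. Qed.

Lemma sum_list_prod {A B : Type} (f : A * B -> R) (l : list A) (l' : list B) :
  lsum f (list_prod l l') = lsum (fun x => lsum (fun y => f (x, y)) l') l.
Proof.
  induction l as [|a l IH]; [reflexivity|].
  simpl list_prod; rewrite sum_app, IH, sum_map; reflexivity.
Qed.

Lemma sum_filter {A : Type} (p : A -> bool) (f : A -> R) (l : list A) :
  lsum f (filter p l) = lsum (fun x => if p x then f x else 0) l.
Proof.
  induction l as [|a l IH]; [reflexivity|].
  simpl; destruct (p a) eqn:E; unfold lsum in *; simpl; rewrite E, IH; lra.
Qed.

Lemma sum_ge_term {A : Type} (f : A -> R) (l : list A) (x : A) :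
  (forall y, In y l -> 0 <= f y) -> In x l -> f x <= lsum f l.
Proof.
  induction l as [|a l IH]; intros H Hx; [destruct Hx|].
  change (lsum f (a :: l)) with (f a + lsum f l).
  assert (0 <= f a) by (apply H; now left).
  assert (0 <= lsum f l) by (apply sum_nonneg; intros y Hy; apply H; now right).
  destruct Hx as [->|Hx]; [lra|].
  enough (f x <= lsum f l) by lra.
  apply IH; trivial; intros y Hy; apply H; now right.
Qed.

Lemma sum_seq_nth {A : Type} (f : A -> R) (l : list A) (d : A) :
  lsum (fun i => f (nth i l d)) (seq 0 (length l)) = lsum f l.
Proof.
  induction l as [|a l IH]; [reflexivity|].
  simpl length; rewrite <- cons_seq.
  change (f a + lsum (fun i => f (nth i (a :: l) d)) (seq 1 (length l)) = f a + lsum f l).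
  rewrite <- seq_shift, sum_map; f_equal; exact IH.
Qed.

(** Excluded middle makes every proposition countable, so that predicates with quantifiers over
    nodes or cells can be summed directly as reals. *)
Definition ind (P : Prop) : R := if excluded_middle_informative P then 1 else 0.

Lemma ind_true (P : Prop) : P -> ind P = 1.
Proof. intros H; unfold ind; destruct excluded_middle_informative; tauto. Qed.

Lemma ind_false (P : Prop) : ~ P -> ind P = 0.
Proof. intros H; unfold ind; destruct excluded_middle_informative; tauto. Qed.

Lemma ind_bounds (P : Prop) : 0 <= ind P <= 1.
Proof. unfold ind; destruct excluded_middle_informative; lra. Qed.

Lemma ind_le (P Q : Prop) : (P -> Q) -> ind P <= ind Q.
Proof.
  intros H; unfold ind; destruct (excluded_middle_informative P),
    (excluded_middle_informative Q); try lra; tauto.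
Qed.

Lemma ind_iff (P Q : Prop) : (P <-> Q) -> ind P = ind Q.
Proof. intros H; apply Rle_antisym; apply ind_le; tauto. Qed.

Lemma ind_and (P Q : Prop) : ind (P /\ Q) = ind P * ind Q.
Proof. unfold ind; repeat destruct excluded_middle_informative; try lra; tauto. Qed.

Lemma ind_not (P : Prop) : ind (~ P) = 1 - ind P.
Proof. unfold ind; repeat destruct excluded_middle_informative; try lra; tauto. Qed.

Lemma sum_ind_eq {A : Type} (g : A -> R) (l : list A) (x : A) :
  NoDup l -> In x l -> lsum (fun c => ind (x = c) * g c) l = g x.
Proof.
  induction l as [|a l IH]; intros Hl Hx; [destruct Hx|].
  change (ind (x = a) * g a + lsum (fun c => ind (x = c) * g c) l = g x).
  inversion Hl as [|? ? Ha Hl']; subst.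
  destruct (classic (x = a)) as [->|Hne].
  - rewrite ind_true by trivial.
    rewrite (sum_ext _ (fun _ => 0)), sum_const; [lra|].
    intros y Hy; rewrite ind_false; [lra|]. intros ->; tauto.
  - rewrite ind_false by trivial. destruct Hx as [->|Hx]; [tauto|].
    rewrite IH by trivial; lra.
Qed.

(** Counting by fibres of [h]: each indicator is expanded over the unique class containing the
    point, and the two sums are exchanged. *)
Lemma sum_ind_classes {A B : Type} (h : A -> B) (S : B -> Prop) (l : list A) (cs : list B) :
  NoDup cs -> (forall x, In x l -> In (h x) cs) ->
  lsum (fun x => ind (S (h x))) l
  = lsum (fun c => ind (S c) * lsum (fun x => ind (h x = c)) l) cs.
Proof.
  intros Hcs Hh.
  rewrite (sum_ext _ (fun x => lsum (fun c => ind (h x = c) * ind (S c)) cs)).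
  2:{ intros x Hx; now rewrite (sum_ind_eq (fun c => ind (S c))) by auto. }
  rewrite sum_swap; apply sum_ext; intros c _.
  rewrite <- sum_scal; apply sum_ext; intros; lra.
Qed.

(** * Isoperimetry in the grid of cells *)

(** If no such pair existed, [f] would spread from [p] to every index by induction on the distance
    to [p], and so reach [q]. *)
Lemma discrete_boundary (m : nat) (f : nat -> Prop) :
  (exists i, (i < m)%nat /\ f i) -> (exists i, (i < m)%nat /\ ~ f i) ->
  exists i j, (i < m)%nat /\ (j < m)%nat /\ ~ f i /\ f j /\ (i <= S j)%nat /\ (j <= S i)%nat.
Proof.
  intros [p [Hp Hfp]] [q [Hq Hfq]].
  destruct (classic (exists i j, (i < m)%nat /\ (j < m)%nat /\ ~ f i /\ f j /\
    (i <= S j)%nat /\ (j <= S i)%nat)) as [H|H]; [exact H|exfalso].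
  assert (Hall : forall d i, (i < m)%nat -> (p + d = i \/ i + d = p)%nat -> f i).
  { induction d as [|d IH]; intros i Hi [E|E].
    - now replace i with p by lia.
    - now replace i with p by lia.
    - apply NNPP; intros Hfi; apply H; exists i, (i - 1)%nat.
      repeat split; try lia; trivial. apply IH; lia.
    - apply NNPP; intros Hfi; apply H; exists i, (i + 1)%nat.
      repeat split; try lia; trivial. apply IH; lia. }
  apply Hfq; destruct (le_lt_dec p q).
  - apply (Hall (q - p)%nat); lia.
  - apply (Hall (p - q)%nat); lia.
Qed.

Definition cells (m : nat) : list pt := list_prod (seq 0 m) (seq 0 m).

Lemma in_cells (m : nat) (c : pt) : In c (cells m) <-> (fst c < m /\ snd c < m)%nat.
Proof.
  destruct c as [i j]; etransitivity; [apply in_prod_iff|rewrite !in_seq; simpl; lia].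
Qed.

Lemma sum_cells (f : pt -> R) (m : nat) :
  lsum f (cells m) = lsum (fun i => lsum (fun j => f (i, j)) (seq 0 m)) (seq 0 m).
Proof. exact (sum_list_prod f (seq 0 m) (seq 0 m)). Qed.

Lemma length_cells (m : nat) : length (cells m) = (m * m)%nat.
Proof. etransitivity; [apply length_prod|now rewrite length_seq]. Qed.

Lemma NoDup_cells (m : nat) : NoDup (cells m).
Proof.
  unfold cells; generalize (seq_NoDup m 0).
  generalize (seq 0 m) at 1 2 as l; intros l Hl.
  pose proof (seq_NoDup m 0) as Hs.
  induction Hl as [|i l Hi Hl IH]; simpl; [constructor|].
  apply NoDup_app; trivial.
  - apply NoDup_map_NoDup_ForallPairs; trivial.
    intros j j' _ _ E; now inversion E.
  - intros c Hc Hc'; apply in_map_iff in Hc; destruct Hc as [j [<- _]].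
    apply in_prod_iff in Hc'; tauto.
Qed.

(** Chebyshev distance at most 1: a cell is near itself and its eight neighbours. *)
Definition near (c c' : pt) : Prop :=
  (fst c <= S (fst c') /\ fst c' <= S (fst c) /\
   snd c <= S (snd c') /\ snd c' <= S (snd c))%nat.

(** The outer vertex boundary of [A] for the relation [near]. *)
Definition bdry (m : nat) (A : pt -> Prop) (c : pt) : Prop :=
  ~ A c /\ exists c', In c' (cells m) /\ A c' /\ near c' c.

Section Isoperimetry.

Variables (m : nat) (A : pt -> Prop).

Let row_hit (i : nat) : Prop := exists j, (j < m)%nat /\ A (i, j).
Let col_hit (j : nat) : Prop := exists i, (i < m)%nat /\ A (i, j).
Let row_miss (i : nat) : Prop := exists j, (j < m)%nat /\ ~ A (i, j).
Let col_miss (j : nat) : Prop := exists i, (i < m)%nat /\ ~ A (i, j).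

Let bd : R := lsum (fun c => ind (bdry m A c)) (cells m).

(** A row that meets both [A] and its complement contains a boundary cell by [discrete_boundary],
    and distinct rows give distinct cells. *)
Lemma mixed_rows_le_bdry (Q : nat -> Prop) :
  (forall i, (i < m)%nat -> Q i -> row_hit i /\ row_miss i) ->
  lsum (fun i => ind (Q i)) (seq 0 m) <= bd.
Proof.
  intros HQ; unfold bd; rewrite sum_cells; apply sum_le; intros i Hi.
  apply in_seq in Hi.
  destruct (classic (Q i)) as [Hq|Hq].
  2:{ rewrite ind_false by trivial; apply sum_nonneg; intros; apply ind_bounds. }
  destruct (HQ i) as [H1 H2]; trivial; [lia|].
  destruct (discrete_boundary m (fun j => A (i, j)) H1 H2)
    as (j & j' & Hj & Hj' & Hn & Ha & Hjj & Hjj').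
  rewrite ind_true by trivial.
  rewrite <- (ind_true (bdry m A (i, j))).
  - apply (sum_ge_term (fun j => ind (bdry m A (i, j)))).
    + intros; apply ind_bounds.
    + apply in_seq; lia.
  - split; trivial. exists (i, j'); rewrite in_cells; unfold near; simpl; intuition lia.
Qed.

Lemma mixed_cols_le_bdry (Q : nat -> Prop) :
  (forall j, (j < m)%nat -> Q j -> col_hit j /\ col_miss j) ->
  lsum (fun j => ind (Q j)) (seq 0 m) <= bd.
Proof.
  intros HQ; unfold bd; rewrite sum_cells, sum_swap; apply sum_le; intros j Hj.
  apply in_seq in Hj.
  destruct (classic (Q j)) as [Hq|Hq].
  2:{ rewrite ind_false by trivial; apply sum_nonneg; intros; apply ind_bounds. }
  destruct (HQ j) as [H1 H2]; trivial; [lia|].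
  destruct (discrete_boundary m (fun i => A (i, j)) H1 H2)
    as (i & i' & Hi & Hi' & Hn & Ha & Hii & Hii').
  rewrite ind_true by trivial.
  rewrite <- (ind_true (bdry m A (i, j))).
  - apply (sum_ge_term (fun i => ind (bdry m A (i, j)))).
    + intros; apply ind_bounds.
    + apply in_seq; lia.
  - split; trivial. exists (i', j); rewrite in_cells; unfold near; simpl; intuition lia.
Qed.

Lemma sum_cells_le_rect (S : pt -> Prop) (Q Q' : nat -> Prop) :
  (forall i j, (i < m)%nat -> (j < m)%nat -> S (i, j) -> Q i /\ Q' j) ->
  lsum (fun c => ind (S c)) (cells m)
  <= lsum (fun i => ind (Q i)) (seq 0 m) * lsum (fun j => ind (Q' j)) (seq 0 m).
Proof.
  intros H; rewrite sum_cells, Rmult_comm, <- sum_scal.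
  apply sum_le; intros i Hi; rewrite Rmult_comm, <- sum_scal.
  apply sum_le; intros j Hj; rewrite <- ind_and; apply ind_le.
  apply in_seq in Hi, Hj; apply H; lia.
Qed.

Lemma sum_seq_ind_le (Q : nat -> Prop) : 0 <= lsum (fun i => ind (Q i)) (seq 0 m) <= INR m.
Proof.
  split; [apply sum_nonneg; intros; apply ind_bounds|].
  rewrite <- (length_seq m 0) at 2; rewrite <- (Rmult_1_r (INR _)), <- sum_const.
  apply sum_le; intros; apply ind_bounds.
Qed.

(* A full row meets every column: if some row is full but no column is, then all columns
   are mixed, and likewise with rows and columns exchanged.  In the remaining cases [A] or
   its complement is contained in (mixed rows) x (mixed columns). *)
Lemma isoperimetry :
  lsum (fun c => ind (A c)) (cells m) <= bd * bd \/
  lsum (fun c => ind (~ A c)) (cells m) <= bd * bd.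
Proof.
  (* A boundary at least as large as the side is enough, because [A] has at most [m * m] cells. *)
  assert (Hfull : INR m <= bd -> lsum (fun c => ind (A c)) (cells m) <= bd * bd).
  { intros Hm. eapply Rle_trans.
    - apply (sum_cells_le_rect A (fun _ => True) (fun _ => True)); tauto.
    - pose proof (sum_seq_ind_le (fun _ => True)); nra. }
  assert (Hone : lsum (fun i => ind True) (seq 0 m) = INR m).
  { rewrite ind_true, sum_const, length_seq by trivial; lra. }
  destruct (classic (exists i, (i < m)%nat /\ ~ row_miss i)) as [[i0 [Hi0 Hr]]|Hr];
  destruct (classic (exists j, (j < m)%nat /\ ~ col_miss j)) as [[j0 [Hj0 Hc]]|Hc].
  - right. eapply Rle_trans.
    + apply (sum_cells_le_rect (fun c => ~ A c) row_miss col_miss).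
      intros i j Hi Hj Ha; split; [exists j|exists i]; tauto.
    + apply Rmult_le_compat; try apply sum_seq_ind_le.
      * apply mixed_rows_le_bdry; intros i Hi Hm; split; trivial.
        exists j0; split; trivial. apply NNPP; intros Ha; apply Hc; exists i; tauto.
      * apply mixed_cols_le_bdry; intros j Hj Hm; split; trivial.
        exists i0; split; trivial. apply NNPP; intros Ha; apply Hr; exists j; tauto.
  - left; apply Hfull; rewrite <- Hone; apply (mixed_cols_le_bdry (fun _ => True)).
    intros j Hj _; split.
    + exists i0; split; trivial. apply NNPP; intros Ha; apply Hr; exists j; tauto.
    + apply NNPP; intros Hm; apply Hc; exists j; tauto.
  - left; apply Hfull; rewrite <- Hone; apply (mixed_rows_le_bdry (fun _ => True)).
    intros i Hi _; split.
    + exists j0; split; trivial. apply NNPP; intros Ha; apply Hc; exists i; tauto.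
    + apply NNPP; intros Hm; apply Hr; exists i; tauto.
  - left. eapply Rle_trans.
    + apply (sum_cells_le_rect A row_hit col_hit).
      intros i j Hi Hj Ha; split; [exists j|exists i]; tauto.
    + apply Rmult_le_compat; try apply sum_seq_ind_le.
      * apply mixed_rows_le_bdry; intros i Hi Hm; split; trivial.
        apply NNPP; intros Hm'; apply Hr; exists i; tauto.
      * apply mixed_cols_le_bdry; intros j Hj Hm; split; trivial.
        apply NNPP; intros Hm'; apply Hc; exists j; tauto.
Qed.

End Isoperimetry.

(** * One round of flooding *)

(** Growth proportional to the square root, which is what isoperimetry provides, becomes a constant
    increment of the square root. *)
Lemma sqrt_step (u w d : R) :
  0 <= u -> 0 < d -> u + d * sqrt u <= w -> d * d <= w -> sqrt u + d / 3 <= sqrt w.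
Proof.
  intros Hu Hd H1 H2.
  pose proof (sqrt_pos u) as Hs; pose proof (sqrt_sqrt u Hu) as Hq.
  rewrite <- (sqrt_square (sqrt u + d / 3)) by lra.
  apply sqrt_le_1_alt.
  (* If [d / 3 <= sqrt u], the square of [sqrt u + d / 3] is at most [u + d * sqrt u]; otherwise it
     is at most [4 * d * d / 9]. *)
  destruct (Rle_dec (d / 3) (sqrt u)); nra.
Qed.

Section FloodingRound.

Variables (n m : nat) (cell : nat -> pt) (adj : nat -> nat -> Prop) (a b : R).
Hypothesis a_gt0 : 0 < a.
Hypothesis a_le_b : a <= b.
Hypothesis cell_in : forall t, (t < n)%nat -> In (cell t) (cells m).
Hypothesis near_adj : forall i j, (i < n)%nat -> (j < n)%nat ->
  near (cell i) (cell j) -> adj i j.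
Hypothesis occupancy : forall c, In c (cells m) ->
  a <= lsum (fun t => ind (cell t = c)) (seq 0 n) <= b.

Definition informed (k : nat) (J : nat -> Prop) : R := lsum (fun t => ind (J t)) (seq 0 k).
Definition uninformed (k : nat) (J : nat -> Prop) : R := lsum (fun t => ind (~ J t)) (seq 0 k).
Definition potential (k : nat) (J : nat -> Prop) : R :=
  sqrt (informed k J) - sqrt (uninformed k J).

Variables J J' : nat -> Prop.
Hypothesis J_incr : forall t, J t -> J' t.
Hypothesis J_adj : forall i j, (i < n)%nat -> (j < n)%nat -> J i -> adj i j -> J' j.

Let touched (c : pt) : Prop := exists t, (t < n)%nat /\ J t /\ cell t = c.
Let k : R := lsum (fun c => ind (touched c)) (cells m).
Let k' : R := lsum (fun c => ind (~ touched c)) (cells m).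
Let bd : R := lsum (fun c => ind (bdry m touched c)) (cells m).

(** The exchange rate between numbers of cells and numbers of nodes: group the nodes by cell and
    apply [occupancy] to each one. *)
Lemma nodes_in_cells_bounds (S : pt -> Prop) :
  a * lsum (fun c => ind (S c)) (cells m) <= lsum (fun t => ind (S (cell t))) (seq 0 n)
  <= b * lsum (fun c => ind (S c)) (cells m).
Proof.
  rewrite (sum_ind_classes cell S (seq 0 n) (cells m)); [|apply NoDup_cells|].
  2:{ intros t Ht; apply in_seq in Ht; apply cell_in; lia. }
  rewrite <- !sum_scal; split; apply sum_le; intros c Hc;
    pose proof (occupancy c Hc); pose proof (ind_bounds (S c)); nra.
Qed.

Lemma near_refl (c : pt) : near c c.
Proof. unfold near; lia. Qed.

Lemma touched_informed (t : nat) : (t < n)%nat -> touched (cell t) -> J' t.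
Proof.
  intros Ht [i [Hi [HJ E]]]; apply (J_adj i t); trivial.
  apply near_adj; trivial; rewrite E; apply near_refl.
Qed.

(** An informed node would make its own cell touched, so nodes in boundary cells are all new; a
    touched neighbouring cell informs them. *)
Lemma bdry_informed (t : nat) : (t < n)%nat -> bdry m touched (cell t) -> ~ J t /\ J' t.
Proof.
  intros Ht [Hn [c [_ [[i [Hi [HJ E]]] Hc]]]]; split.
  - intros HJt; apply Hn; exists t; tauto.
  - apply (J_adj i t); trivial; apply near_adj; trivial; now rewrite E.
Qed.

Lemma bd_ge0 : 0 <= bd.
Proof. apply sum_nonneg; intros; apply ind_bounds. Qed.

Lemma informed_le_touched : informed n J <= b * k.
Proof.
  eapply Rle_trans; [|apply nodes_in_cells_bounds].
  apply sum_le; intros t Ht; apply in_seq in Ht; apply ind_le; intros HJ.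
  exists t; intuition lia.
Qed.

Lemma uninformed_le_untouched : uninformed n J' <= b * k'.
Proof.
  eapply Rle_trans; [|apply (nodes_in_cells_bounds (fun c => ~ touched c))].
  apply sum_le; intros t Ht; apply in_seq in Ht; apply ind_le; intros HJ HT.
  apply HJ, touched_informed; trivial; lia.
Qed.

Lemma informed_grows : informed n J + a * bd <= informed n J'.
Proof.
  eapply Rle_trans; [apply Rplus_le_compat_l, (nodes_in_cells_bounds (bdry m touched))|].
  unfold informed; rewrite <- sum_plus; apply sum_le; intros t Ht; apply in_seq in Ht.
  destruct (classic (bdry m touched (cell t))) as [H|H].
  - rewrite (ind_true _ H); apply bdry_informed in H; [|lia].
    rewrite (ind_false (J t)), (ind_true (J' t)) by tauto; lra.
  - rewrite (ind_false _ H), Rplus_0_r; apply ind_le, J_incr.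
Qed.

Lemma informed_plus_uninformed (L : nat -> Prop) : informed n L + uninformed n L = INR n.
Proof.
  unfold informed, uninformed; rewrite <- sum_plus.
  rewrite (sum_ext _ (fun _ => 1)), sum_const, length_seq; [lra|].
  intros; rewrite ind_not; lra.
Qed.

(** For the round that brings the uninformed count below [a]: it may gain less than a full step, but
    it loses nothing. *)
Lemma potential_round_mono : potential n J <= potential n J'.
Proof.
  pose proof (informed_plus_uninformed J); pose proof (informed_plus_uninformed J').
  assert (informed n J <= informed n J').
  { apply sum_le; intros; apply ind_le; auto. }
  unfold potential.
  assert (sqrt (informed n J) <= sqrt (informed n J')) by (apply sqrt_le_1_alt; lra).
  assert (sqrt (uninformed n J') <= sqrt (uninformed n J)) by (apply sqrt_le_1_alt; lra).
  lra.
Qed.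

(** Puts the isoperimetric bound into the form required by [sqrt_step], with [d = a / sqrt b]. *)
Lemma boundary_gain (x : R) : 0 <= x -> x <= b * (bd * bd) ->
  a / sqrt b * sqrt x <= a * bd.
Proof.
  intros Hx H; pose proof bd_ge0.
  assert (0 < sqrt b) by (apply sqrt_lt_R0; lra).
  assert (sqrt x <= sqrt b * bd).
  { rewrite <- (sqrt_square bd) by trivial; rewrite <- sqrt_mult; [|lra|nra].
    now apply sqrt_le_1_alt. }
  apply Rmult_le_reg_r with (sqrt b); trivial.
  replace (a / sqrt b * sqrt x * sqrt b) with (a * sqrt x) by (field; lra).
  nra.
Qed.

(** An untouched cell would by itself contain at least [a] uninformed nodes, so every cell is
    touched. *)
Lemma flooding_completes : uninformed n J < a -> uninformed n J' = 0.
Proof.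
  intros Hlt; unfold uninformed.
  rewrite (sum_ext _ (fun _ => 0)), sum_const; [lra|].
  intros t Ht; apply in_seq in Ht; rewrite ind_not, ind_true; [lra|].
  apply touched_informed; [lia|]. apply NNPP; intros HT.
  pose proof (occupancy (cell t) (cell_in t ltac:(lia))) as [Ho _].
  enough (lsum (fun i => ind (cell i = cell t)) (seq 0 n) <= uninformed n J) by lra.
  apply sum_le; intros i Hi; apply in_seq in Hi; apply ind_le; intros E HJ.
  apply HT; exists i; intuition lia.
Qed.

(** The two cases of [isoperimetry] move different terms: either the root of the informed count
    grows, or the root of the uninformed count shrinks. The other term is monotone. *)
Lemma potential_step (s : nat) : (s < n)%nat -> J s ->
  potential n J + a / sqrt b / 3 <= potential n J' \/ uninformed n J' < a.
Proof.
  intros s_lt J_s.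
  assert (Hb : 0 < sqrt b) by (apply sqrt_lt_R0; lra).
  assert (Hd : 0 < a / sqrt b) by now apply Rdiv_lt_0_compat.
  assert (Hda : a / sqrt b * (a / sqrt b) <= a).
  { replace (a / sqrt b * (a / sqrt b)) with (a * (a / (sqrt b * sqrt b))) by (field; lra).
    rewrite sqrt_sqrt by lra.
    assert (a / b <= 1) by 
      (apply Rmult_le_reg_r with b; [lra|]; unfold Rdiv; rewrite Rmult_assoc, Rinv_l; lra).
    nra. }
  pose proof bd_ge0 as Hbd; pose proof informed_grows as Hg.
  pose proof (informed_plus_uninformed J) as HJ; pose proof (informed_plus_uninformed J') as HJ'.
  assert (Hi : 0 <= informed n J) by (apply sum_nonneg; intros; apply ind_bounds).
  assert (Hu : 0 <= uninformed n J') by (apply sum_nonneg; intros; apply ind_bounds).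
  pose proof informed_le_touched as Hk; pose proof uninformed_le_untouched as Hk'.
  unfold potential.
  destruct (isoperimetry m touched) as [H|H]; fold bd in H.
  - left. fold k in H.
    (* The source's cell is touched, so the boundary is nonempty and at least [a] nodes are gained;
       this gives the hypothesis [d * d <= w] of [sqrt_step]. *)
    assert (1 <= k).
    { rewrite <- (ind_true (touched (cell s))) by (exists s; tauto).
      apply (sum_ge_term (fun c => ind (touched c))); [intros; apply ind_bounds|auto]. }
    assert (1 <= bd) by nra.
    assert (sqrt (informed n J) + a / sqrt b / 3 <= sqrt (informed n J')).
    { apply sqrt_step; trivial; [|nra].
      pose proof (boundary_gain (informed n J) Hi); nra. }
    assert (sqrt (uninformed n J') <= sqrt (uninformed n J)) by (apply sqrt_le_1_alt; nra).
    lra.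
  - fold k' in H.
    (* Below [d * d <= a] uninformed nodes, the second alternative already holds. *)
    destruct (Rle_dec (a / sqrt b * (a / sqrt b)) (uninformed n J)) as [Hl|Hl]; [left|right; nra].
    (* [sqrt_step] is read backwards in time, from the uninformed count after the round to the
       larger count before it. *)
    assert (sqrt (uninformed n J') + a / sqrt b / 3 <= sqrt (uninformed n J)).
    { apply sqrt_step; trivial.
      pose proof (boundary_gain (uninformed n J') Hu); nra. }
    assert (sqrt (informed n J) <= sqrt (informed n J')) by (apply sqrt_le_1_alt; nra).
    lra.
Qed.

End FloodingRound.

(** * Product expectations and stationarity *)

Definition is_prob (d : dist) : Prop :=
  (forall wx, In wx d -> 0 <= fst wx) /\ lsum fst d = 1.

Definition in_support (d : dist) (x : pt) : Prop := exists w, In (w, x) d.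

Lemma Eprod_cons (d : dist) (ds : list dist) (g : list pt -> R) :
  Eprod (d :: ds) g = lsum (fun wx => fst wx * Eprod ds (fun l => g (snd wx :: l))) d.
Proof. reflexivity. Qed.

(** The comparison is asked only on the support, because the later bounds hold only for positions on
    the grid. *)
Lemma Eprod_le (ds : list dist) (g h : list pt -> R) :
  Forall is_prob ds -> (forall l, Forall2 in_support ds l -> g l <= h l) ->
  Eprod ds g <= Eprod ds h.
Proof.
  intros Hds; revert g h; induction Hds as [|d ds [Hd _] Hds IH]; intros g h H.
  - apply H; constructor.
  - rewrite !Eprod_cons; apply sum_le; intros [w x] Hx.
    apply Rmult_le_compat_l; [now apply Hd|].
    apply IH; intros l Hl; apply H; constructor; trivial; now exists w.
Qed.

Lemma Eprod_ext (ds : list dist) (g h : list pt -> R) :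
  (forall l, g l = h l) -> Eprod ds g = Eprod ds h.
Proof.
  revert g h; induction ds as [|d ds IH]; intros g h H; [apply H|].
  rewrite !Eprod_cons; apply sum_ext; intros wx _; f_equal; apply IH; intros; apply H.
Qed.

Lemma Eprod_plus (ds : list dist) (g h : list pt -> R) :
  Eprod ds (fun l => g l + h l) = Eprod ds g + Eprod ds h.
Proof.
  revert g h; induction ds as [|d ds IH]; intros g h; [reflexivity|].
  rewrite !Eprod_cons, <- sum_plus; apply sum_ext; intros wx _.
  rewrite (IH (fun l => g (snd wx :: l)) (fun l => h (snd wx :: l))); lra.
Qed.

Lemma Eprod_scal (ds : list dist) (c : R) (g : list pt -> R) :
  Eprod ds (fun l => c * g l) = c * Eprod ds g.
Proof.
  revert g; induction ds as [|d ds IH]; intros g; [reflexivity|].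
  rewrite !Eprod_cons, <- sum_scal; apply sum_ext; intros wx _.
  rewrite (IH (fun l => g (snd wx :: l))); lra.
Qed.

Lemma Eprod_const (ds : list dist) (c : R) :
  Forall is_prob ds -> Eprod ds (fun _ => c) = c.
Proof.
  induction 1 as [|d ds [_ Hd] _ IH]; [reflexivity|].
  rewrite Eprod_cons, (sum_ext _ (fun wx => c * fst wx)), sum_scal, Hd; [lra|].
  intros; rewrite IH; lra.
Qed.

Lemma Eprod_sum {A : Type} (ds : list dist) (g : A -> list pt -> R) (cs : list A) :
  Eprod ds (fun l => lsum (fun c => g c l) cs) = lsum (fun c => Eprod ds (g c)) cs.
Proof.
  induction cs as [|c cs IH].
  (* Writing the zero as a product lets [Eprod_scal] handle it without assuming that the weights sum
     to 1. *)
  - transitivity (Eprod ds (fun l => 0 * 0)); [apply Eprod_ext; intros; unfold lsum; simpl; lra|].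
    rewrite (Eprod_scal ds 0 (fun _ => 0)); unfold lsum; simpl; lra.
  - change (lsum (fun c => Eprod ds (g c)) (c :: cs))
      with (Eprod ds (g c) + lsum (fun c => Eprod ds (g c)) cs).
    rewrite <- IH, <- Eprod_plus; reflexivity.
Qed.

(** Independence turns the exponential of a sum into a product of moments; the free constant [c]
    absorbs the head coordinate in the induction. *)
Lemma Eprod_exp_sum (d : dist) (f : pt -> R) (c : R) (n : nat) :
  Eprod (repeat d n) (fun P => exp (c + lsum f P))
  = exp c * lsum (fun wx => fst wx * exp (f (snd wx))) d ^ n.
Proof.
  revert c; induction n as [|n IH]; intros c.
  - simpl; unfold lsum at 1; simpl; rewrite Rplus_0_r; lra.
  - simpl repeat; rewrite Eprod_cons.
    rewrite (sum_ext _ (fun wx => (exp c * lsum (fun wx => fst wx * exp (f (snd wx))) d ^ n)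
      * (fst wx * exp (f (snd wx))))).
    + rewrite sum_scal; simpl; ring.
    + intros [w x] _; simpl.
      rewrite (Eprod_ext _ _ (fun P => exp ((c + f x) + lsum f P))).
      * rewrite IH, exp_plus; ring.
      * intros l; f_equal; unfold lsum; simpl; ring.
Qed.

Lemma exp_nat_mult (n : nat) (x : R) : exp x ^ n = exp (INR n * x).
Proof.
  induction n as [|n IH]; [simpl; rewrite Rmult_0_l, exp_0; reflexivity|].
  rewrite S_INR; simpl; rewrite IH, <- exp_plus; f_equal; ring.
Qed.

(** The Chernoff estimate: one node contributes the factor [1 + (exp t - 1) * q], with [q] the mass
    of [S], and [1 + x <= exp x]. *)
Lemma occupancy_mgf (d : dist) (S : pt -> Prop) (c t : R) (n : nat) :
  is_prob d ->
  Eprod (repeat d n) (fun P => exp (c + t * lsum (fun x => ind (S x)) P))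
  <= exp (c + INR n * ((exp t - 1) * lsum (fun wx => fst wx * ind (S (snd wx))) d)).
Proof.
  intros [Hd0 Hd1].
  rewrite (Eprod_ext _ _ (fun P => exp (c + lsum (fun x => t * ind (S x)) P)))
    by (intros; now rewrite sum_scal).
  rewrite Eprod_exp_sum, exp_plus; apply Rmult_le_compat_l; [left; apply exp_pos|].
  rewrite <- exp_nat_mult; apply pow_incr; split.
  - apply sum_nonneg; intros wx Hw; apply Rmult_le_pos; [auto|left; apply exp_pos].
  - eapply Rle_trans; [|apply exp_ineq1_le].
    rewrite <- Hd1 at 1; rewrite <- sum_scal, <- sum_plus; right; apply sum_ext; intros wx _.
    destruct (classic (S (snd wx))) as [H|H].
    + rewrite ind_true by trivial; rewrite !Rmult_1_r; ring.
    + rewrite ind_false by trivial; rewrite !Rmult_0_r, exp_0; ring.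
Qed.

Lemma Rleb_true (x y : R) : Rleb x y = true <-> x <= y.
Proof. unfold Rleb; destruct Rle_dec; split; intros; trivial; easy. Qed.

Lemma gdist_sym (eps : R) (x y : pt) : gdist eps x y = gdist eps y x.
Proof. unfold gdist; f_equal; ring. Qed.

Lemma gdist_refl (eps : R) (x : pt) : gdist eps x x = 0.
Proof. unfold gdist; rewrite <- sqrt_0; f_equal; ring. Qed.

(** * The stationary walk of the nodes *)

Section Walk.

Variables (n : nat) (r eps : R).
Hypothesis r_ge0 : 0 <= r.

Let L : list pt := grid n eps.
Let deg (x : pt) : R := INR (length (Gamma n eps r x)).

Lemma deg_sum (x : pt) : deg x = lsum (fun y => if Rleb (gdist eps x y) r then 1 else 0) L.
Proof.
  unfold deg, Gamma; rewrite <- sum_filter, sum_const, Rmult_1_r; reflexivity.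
Qed.

Lemma deg_gt0 (x : pt) : In x L -> 0 < deg x.
Proof.
  intros Hx; apply Rlt_le_trans with 1; [lra|].
  assert (E : Rleb (gdist eps x x) r = true) by (apply Rleb_true; now rewrite gdist_refl).
  rewrite deg_sum.
  apply Rle_trans with (if Rleb (gdist eps x x) r then 1 else 0); [rewrite E; lra|].
  apply (sum_ge_term (fun y => if Rleb (gdist eps x y) r then 1 else 0)); trivial.
  intros y _; destruct (Rleb (gdist eps x y) r); lra.
Qed.

Lemma grid_nonempty : In (0, 0)%nat L.
Proof. apply (in_cells (S (gridM n eps))); simpl; lia. Qed.

Lemma deg_total_gt0 : 0 < lsum deg L.
Proof.
  apply Rlt_le_trans with (deg (0, 0)%nat); [apply deg_gt0, grid_nonempty|].
  apply sum_ge_term; [|apply grid_nonempty]. intros y Hy; left; now apply deg_gt0.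
Qed.

Lemma sum_pi (f : R * pt -> R) :
  lsum f (pi_dist n eps r) = lsum (fun x => f (deg x / lsum deg L, x)) L.
Proof. unfold pi_dist; cbv zeta; rewrite sum_map; reflexivity. Qed.

Lemma sum_step (x : pt) (f : R * pt -> R) :
  lsum f (step_dist n eps r x)
  = lsum (fun y => if Rleb (gdist eps x y) r then f (/ deg x, y) else 0) L.
Proof. unfold step_dist; rewrite sum_map; unfold Gamma; rewrite sum_filter; reflexivity. Qed.

Lemma is_prob_pi : is_prob (pi_dist n eps r).
Proof.
  split.
  - intros wx Hw; apply in_map_iff in Hw; destruct Hw as [x [<- Hx]]; simpl.
    pose proof deg_total_gt0.
    apply Rmult_le_pos; [apply pos_INR|left; now apply Rinv_0_lt_compat].
  - rewrite sum_pi; simpl.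
    rewrite (sum_ext _ (fun x => / lsum deg L * deg x)), sum_scal.
    + apply Rinv_l; pose proof deg_total_gt0; lra.
    + intros; unfold Rdiv; ring.
Qed.

Lemma is_prob_step (x : pt) : In x L -> is_prob (step_dist n eps r x).
Proof.
  intros Hx; pose proof (deg_gt0 x Hx) as Hd; split.
  - intros wx Hw; apply in_map_iff in Hw; destruct Hw as [y [<- _]]; simpl.
    left; now apply Rinv_0_lt_compat.
  - rewrite sum_step; simpl.
    rewrite (sum_ext _ (fun y => / deg x * (if Rleb (gdist eps x y) r then 1 else 0))).
    + rewrite sum_scal, <- deg_sum; apply Rinv_l; lra.
    + intros y _; simpl; destruct Rleb; lra.
Qed.

Lemma in_support_pi (x : pt) : in_support (pi_dist n eps r) x -> In x L.
Proof.
  intros [w Hw]; apply in_map_iff in Hw; destruct Hw as [y [E Hy]]; now inversion E; subst.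
Qed.

Lemma in_support_step (x y : pt) : in_support (step_dist n eps r x) y -> In y L.
Proof.
  intros [w Hw]; apply in_map_iff in Hw; destruct Hw as [z [E Hz]]; inversion E; subst.
  now apply filter_In in Hz.
Qed.

(* Stationarity of [pi], through the symmetry of the relation [y \in Gamma x]. *)
Lemma pi_step (h : pt -> R) :
  lsum (fun wx => fst wx * lsum (fun wy => fst wy * h (snd wy)) (step_dist n eps r (snd wx)))
    (pi_dist n eps r)
  = lsum (fun wx => fst wx * h (snd wx)) (pi_dist n eps r).
Proof.
  rewrite !sum_pi; simpl; pose proof deg_total_gt0 as HZ; set (Z := lsum deg L) in *.
  transitivity (lsum (fun x => lsum (fun y =>
    if Rleb (gdist eps x y) r then h y / Z else 0) L) L).
  - apply sum_ext; intros x Hx; rewrite sum_step, <- sum_scal; apply sum_ext; intros y _.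
    pose proof (deg_gt0 x Hx); simpl; destruct Rleb; [field; lra|ring].
  - rewrite sum_swap; apply sum_ext; intros y _; rewrite deg_sum.
    rewrite (sum_ext _ (fun x => h y / Z * (if Rleb (gdist eps y x) r then 1 else 0))).
    + rewrite sum_scal; unfold Rdiv; ring.
    + intros x _; rewrite gdist_sym; destruct Rleb; ring.
Qed.

(** Stationarity of the joint law: [pi_step] treats the head node, and independence leaves the
    others to the induction. *)
Lemma Eprod_pi_step (k : nat) (g : list pt -> R) :
  Eprod (repeat (pi_dist n eps r) k) (fun P => Eprod (map (step_dist n eps r) P) g)
  = Eprod (repeat (pi_dist n eps r) k) g.
Proof.
  revert g; induction k as [|k IH]; intros g; [reflexivity|].
  simpl repeat; rewrite !Eprod_cons.
  rewrite <- (pi_step (fun y => Eprod (repeat (pi_dist n eps r) k) (fun l => g (y :: l)))).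
  apply sum_ext; intros wx _; f_equal.
  rewrite (Eprod_ext _ _ (fun P => lsum (fun wy =>
    fst wy * Eprod (map (step_dist n eps r) P) (fun l => g (snd wy :: l)))
    (step_dist n eps r (snd wx)))) by reflexivity.
  rewrite Eprod_sum; apply sum_ext; intros wy _.
  now rewrite Eprod_scal, IH.
Qed.

Definition on_grid (P : list pt) : Prop := length P = n /\ Forall (fun x => In x (grid n eps)) P.

Lemma on_grid_step (P P' : list pt) :
  on_grid P -> Forall2 in_support (map (step_dist n eps r) P) P' -> on_grid P'.
Proof.
  intros [Hl _] H; split.
  - apply Forall2_length in H; now rewrite length_map, Hl in H.
  - revert P' H; clear Hl; induction P as [|x P IH]; intros P' H; inversion H; subst; constructor.
    + eapply in_support_step; eassumption.
    + now apply IH.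
Qed.

Lemma on_grid_pi (P : list pt) :
  Forall2 in_support (repeat (pi_dist n eps r) n) P -> on_grid P.
Proof.
  intros H; split.
  - apply Forall2_length in H; now rewrite repeat_length in H.
  (* Only the number of copies is generalized; the [n] inside [pi_dist] fixes the grid and must
     stay. *)
  - revert P H; generalize n at 2; intros k; induction k as [|k IH]; intros P H;
      inversion H; subst; constructor.
    + now apply in_support_pi.
    + now apply IH.
Qed.

Lemma is_prob_steps (P : list pt) : on_grid P -> Forall is_prob (map (step_dist n eps r) P).
Proof.
  intros [_ H]; apply Forall_map; revert H; apply Forall_impl; apply is_prob_step.
Qed.

Lemma is_prob_pis (k : nat) : Forall is_prob (repeat (pi_dist n eps r) k).
Proof. apply Forall_forall; intros d Hd; apply repeat_spec in Hd; subst; apply is_prob_pi. Qed.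

(** * Union bound over time for a deterministic invariant of flooding *)

Variables (Rr : R) (bad : list pt -> R).
Hypothesis bad_ge0 : forall P, 0 <= bad P.

(** The expected sum of [bad] over [k] successive times, the first being the present positions
    [P]. *)
Fixpoint total_bad (k : nat) (P : list pt) : R :=
  match k with
  | O => 0
  | S k' => bad P + Eprod (map (step_dist n eps r) P) (total_bad k')
  end.

Lemma Eprod_total_bad (k : nat) :
  Eprod (repeat (pi_dist n eps r) n) (total_bad k)
  = INR k * Eprod (repeat (pi_dist n eps r) n) bad.
Proof.
  induction k as [|k IH].
  - simpl; rewrite Eprod_const by apply is_prob_pis; lra.
  - rewrite S_INR; simpl total_bad; rewrite Eprod_plus, Eprod_pi_step, IH; lra.
Qed.

Lemma total_bad_ge0 (k : nat) (P : list pt) : on_grid P -> 0 <= total_bad k P.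
Proof.
  revert P; induction k as [|k IH]; intros P HP; simpl; [lra|].
  apply Rplus_le_le_0_compat; [apply bad_ge0|].
  rewrite <- (Eprod_const (map (step_dist n eps r) P) 0) by now apply is_prob_steps.
  apply Eprod_le; [now apply is_prob_steps|].
  intros P' H; apply IH; eapply on_grid_step; eassumption.
Qed.

Lemma succ_prob_ge0 (k : nat) (P : list pt) I : on_grid P -> 0 <= succ_prob n r Rr eps k P I.
Proof.
  revert P I; induction k as [|k IH]; intros P I HP; simpl.
  - destruct all_informed; lra.
  - rewrite <- (Eprod_const (map (step_dist n eps r) P) 0) by now apply is_prob_steps.
    apply Eprod_le; [now apply is_prob_steps|].
    intros P' H; apply IH; eapply on_grid_step; eassumption.
Qed.

Variables (Inv : nat -> (nat -> nat -> bool) -> Prop) (K : nat).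
Hypothesis Inv_init : Inv 0 Nat.eqb.
Hypothesis Inv_step : forall t I P, on_grid P -> bad P < 1 -> Inv t I ->
  Inv (S t) (flood_step n Rr eps P I).
Hypothesis Inv_final : forall I, Inv K I -> all_informed n I = true.

(** Markov's inequality and the union bound in one induction on the remaining rounds, without a
    probability space of trajectories. *)
Lemma succ_prob_ge (k t : nat) (P : list pt) I :
  on_grid P -> (t + k = K)%nat -> Inv t I ->
  1 - total_bad k P <= succ_prob n r Rr eps k P I.
Proof.
  revert t P I; induction k as [|k IH]; intros t P I HP Ht HI.
  - simpl; rewrite Inv_final; [lra|]. now replace K with t by lia.
  - destruct (Rlt_dec (bad P) 1) as [Hb|Hb].
    + simpl; pose proof (bad_ge0 P).
      assert (Hp := is_prob_steps P HP).
      apply Rle_trans with (Eprod (map (step_dist n eps r) P) (fun P' => 1 + -1 * total_bad k P')).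
      * rewrite Eprod_plus, Eprod_scal, Eprod_const by trivial. lra.
      * apply Eprod_le; trivial; intros P' HP'.
        pose proof (on_grid_step P P' HP HP') as Hg.
        pose proof (IH (S t) P' (flood_step n Rr eps P I) Hg ltac:(lia)
          (Inv_step t I P HP Hb HI)); lra.
    (* Here [total_bad] is at least 1, so the lower bound is not positive. *)
    + pose proof (succ_prob_ge0 (S k) P I HP).
      assert (bad P <= total_bad (S k) P).
      { simpl; enough (0 <= Eprod (map (step_dist n eps r) P) (total_bad k)) by lra.
        rewrite <- (Eprod_const (map (step_dist n eps r) P) 0) by now apply is_prob_steps.
        apply Eprod_le; [now apply is_prob_steps|].
        intros P' H'; apply total_bad_ge0; eapply on_grid_step; eassumption. }
      lra.
Qed.

Lemma flood_prob_ge :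
  1 - INR K * Eprod (repeat (pi_dist n eps r) n) bad <= flood_prob n r Rr eps K.
Proof.
  unfold flood_prob.
  rewrite <- Eprod_total_bad.
  apply Rle_trans with (Eprod (repeat (pi_dist n eps r) n) (fun P => 1 + -1 * total_bad K P)).
  - rewrite Eprod_plus, Eprod_scal, Eprod_const by apply is_prob_pis; lra.
  - apply Eprod_le; [apply is_prob_pis|]; intros P HP.
    replace (1 + -1 * total_bad K P) with (1 - total_bad K P) by lra.
    apply (succ_prob_ge K 0); trivial. now apply on_grid_pi.
Qed.

End Walk.

(** * Near-uniformity of the stationary law, and the cells *)

(** The absolute difference: one of the truncated subtractions vanishes. *)
Definition ndist (y z : nat) : nat := ((z - y) + (y - z))%nat.

Definition fold_into (M x y z : nat) : nat :=
  let h := (ndist y z / 2)%nat in if (x + h <=? M)%nat then (x + h)%nat else (x - h)%nat.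

Definition fold_code (y z : nat) : nat :=
  (ndist y z mod 2 + (if y <=? z then 0 else 2))%nat.

(** The half displacement [h] satisfies [2 * h <= M], so [x + h > M] forces [x > h]: the reflected
    point [x - h] is never truncated at 0. *)
Lemma fold_into_spec (M x y z : nat) : (x <= M)%nat -> (y <= M)%nat -> (z <= M)%nat ->
  (fold_into M x y z <= M /\ fold_into M x y z <= x + ndist y z /\
   x <= fold_into M x y z + ndist y z)%nat.
Proof.
  intros Hx Hy Hz; unfold fold_into; cbv zeta.
  pose proof (Nat.div_mod_eq (ndist y z) 2); pose proof (Nat.mod_upper_bound (ndist y z) 2).
  assert (ndist y z <= M)%nat by (unfold ndist; lia).
  destruct (Nat.leb_spec (x + ndist y z / 2) M); lia.
Qed.

Lemma fold_code_lt (y z : nat) : (fold_code y z < 4)%nat.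
Proof.
  unfold fold_code; pose proof (Nat.mod_upper_bound (ndist y z) 2).
  destruct (y <=? z)%nat; lia.
Qed.

(** Equal images in opposite branches would force both halves to be 0, where no reflection occurs.
    In a common branch the halves agree, and parity and side then determine the point. *)
Lemma fold_into_inj (M x y z z' : nat) :
  (x <= M)%nat -> (y <= M)%nat -> (z <= M)%nat -> (z' <= M)%nat ->
  fold_into M x y z = fold_into M x y z' -> fold_code y z = fold_code y z' -> z = z'.
Proof.
  intros Hx Hy Hz Hz'; unfold fold_into, fold_code; cbv zeta.
  pose proof (Nat.div_mod_eq (ndist y z) 2); pose proof (Nat.mod_upper_bound (ndist y z) 2).
  pose proof (Nat.div_mod_eq (ndist y z') 2); pose proof (Nat.mod_upper_bound (ndist y z') 2).
  assert (ndist y z <= M /\ ndist y z' <= M)%nat by (unfold ndist; lia).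
  destruct (Nat.leb_spec (x + ndist y z / 2) M), (Nat.leb_spec (x + ndist y z' / 2) M),
    (Nat.leb_spec y z), (Nat.leb_spec y z'); unfold ndist in *; lia.
Qed.

Lemma sq_dist_le (eps : R) (x f y z : nat) :
  (f <= x + ndist y z)%nat -> (x <= f + ndist y z)%nat ->
  (eps * INR x - eps * INR f) ^ 2 <= (eps * INR y - eps * INR z) ^ 2.
Proof.
  intros H1 H2.
  replace ((eps * INR x - eps * INR f) ^ 2) with (eps ^ 2 * (INR x - INR f) ^ 2) by ring.
  replace ((eps * INR y - eps * INR z) ^ 2) with (eps ^ 2 * (INR y - INR z) ^ 2) by ring.
  apply Rmult_le_compat_l; [apply pow2_ge_0|].
  unfold ndist in *; destruct (le_lt_dec y z).
  - assert (H1' : (f + y <= x + z)%nat) by lia; assert (H2' : (x + y <= f + z)%nat) by lia.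
    apply le_INR in H1', H2', l; rewrite !plus_INR in *; nra.
  - assert (H1' : (f + z <= x + y)%nat) by lia; assert (H2' : (x + z <= f + y)%nat) by lia.
    apply lt_INR in l; apply le_INR in H1', H2'; rewrite !plus_INR in *; nra.
Qed.

Lemma in_grid (n : nat) (eps : R) (x : pt) :
  In x (grid n eps) <-> (fst x <= gridM n eps /\ snd x <= gridM n eps)%nat.
Proof. unfold grid; etransitivity; [apply (in_cells (S (gridM n eps)))|]; lia. Qed.

(* Halving the displacement from [y] and reflecting it where it would leave the grid maps
   [Gamma y] into [Gamma x]; [fold_code] records the information lost, 4 values per axis. *)
Lemma Gamma_comparable (n : nat) (eps r : R) (x y : pt) :
  In x (grid n eps) -> In y (grid n eps) ->
  (length (Gamma n eps r y) <= 16 * length (Gamma n eps r x))%nat.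
Proof.
  intros Hx Hy; apply in_grid in Hx, Hy; set (M := gridM n eps) in *.
  pose (F := fun z : pt =>
    ((fold_into M (fst x) (fst y) (fst z), fold_into M (snd x) (snd y) (snd z)),
     (fold_code (fst y) (fst z), fold_code (snd y) (snd z)))).
  rewrite <- (length_map F).
  replace (16 * length (Gamma n eps r x))%nat
    with (length (list_prod (Gamma n eps r x) (cells 4))) by (rewrite length_prod; simpl; lia).
  apply NoDup_incl_length.
  - apply NoDup_map_NoDup_ForallPairs.
    + intros [z1 z2] [w1 w2] Hz Hw E; apply filter_In in Hz, Hw.
      destruct Hz as [Hz _], Hw as [Hw _]; apply in_grid in Hz, Hw; fold M in Hz, Hw.
      simpl in *; inversion E; f_equal.
      * apply (fold_into_inj M (fst x) (fst y)); tauto.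
      * apply (fold_into_inj M (snd x) (snd y)); tauto.
    + apply NoDup_filter, (NoDup_cells (S M)).
  - intros p Hp; apply in_map_iff in Hp; destruct Hp as [z [<- Hz]].
    apply filter_In in Hz; destruct Hz as [Hz Hd]; apply in_grid in Hz; fold M in Hz.
    apply Rleb_true in Hd.
    destruct (fold_into_spec M (fst x) (fst y) (fst z)) as [A1 [A2 A3]]; try tauto.
    destruct (fold_into_spec M (snd x) (snd y) (snd z)) as [B1 [B2 B3]]; try tauto.
    apply in_prod_iff; split.
    + apply filter_In; split; [apply in_grid; tauto|].
      apply Rleb_true; eapply Rle_trans; [|exact Hd].
      apply sqrt_le_1_alt; apply Rplus_le_compat; apply sq_dist_le; simpl; trivial.
    + apply in_cells; split; apply fold_code_lt.
Qed.

(** Averaging [Gamma_comparable] over one of its two points compares each degree with the mean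
    degree, up to a factor 16. *)
Lemma pi_weight_bounds (n : nat) (eps r : R) (S : pt -> Prop) :
  0 <= r ->
  let p := lsum (fun x => ind (S x)) (grid n eps) in
  let N := INR (length (grid n eps)) in
  p / (16 * N) <= lsum (fun wx => fst wx * ind (S (snd wx))) (pi_dist n eps r) <= 16 * p / N.
Proof.
  intros Hr p N; rewrite sum_pi; simpl.
  pose proof (deg_total_gt0 n r eps Hr) as HZ.
  set (deg := fun x : pt => INR (length (Gamma n eps r x))) in *; set (L := grid n eps) in *.
  assert (HN : 0 < N).
  { apply lt_0_INR; pose proof (grid_nonempty n eps) as H; fold L in H.
    destruct L; simpl; [destruct H|lia]. }
  assert (Hc : forall x y, In x L -> In y L -> deg y <= 16 * deg x).
  { intros x y Hx Hy; pose proof (Gamma_comparable n eps r x y Hx Hy) as H.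
    apply le_INR in H; rewrite mult_INR in H;
    replace (INR 16) with 16 in H by (simpl; lra). exact H. }
  assert (HcN : forall x, In x L -> deg x * N <= 16 * lsum deg L /\ lsum deg L <= 16 * deg x * N).
  { intros x Hx; split.
    - rewrite Rmult_comm; unfold N; rewrite <- sum_const, <- sum_scal; apply sum_le.
      intros y Hy; now apply Hc.
    - rewrite Rmult_comm; unfold N; rewrite <- sum_const; apply sum_le.
      intros y Hy; now apply Hc. }
  replace (p / (16 * N)) with (lsum (fun x => / (16 * N) * ind (S x)) L)
    by (rewrite sum_scal; unfold p, Rdiv; ring).
  replace (16 * p / N) with (lsum (fun x => 16 / N * ind (S x)) L)
    by (rewrite sum_scal; unfold p, Rdiv; ring).
  split; apply sum_le; intros x Hx; apply Rmult_le_compat_r; try apply ind_bounds;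
    destruct (HcN x Hx) as [H1 H2].
  - apply Rmult_le_reg_r with (16 * N * lsum deg L); [nra|].
    replace (/ (16 * N) * (16 * N * lsum deg L)) with (lsum deg L) by (field; lra).
    replace (INR (length (Gamma n eps r x)) / lsum deg L * (16 * N * lsum deg L))
      with (16 * deg x * N) by (unfold deg; field; fold deg; lra).
    exact H2.
  - apply Rmult_le_reg_r with (N * lsum deg L); [nra|].
    replace (16 / N * (N * lsum deg L)) with (16 * lsum deg L) by (field; lra).
    replace (INR (length (Gamma n eps r x)) / lsum deg L * (N * lsum deg L))
      with (deg x * N) by (unfold deg; field; fold deg; lra).
    exact H1.
Qed.

Lemma sum_ind_interval (s len N : nat) :
  lsum (fun x => ind (s <= x < s + len)%nat) (seq 0 N) = INR (Nat.min (N - s) len).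
Proof.
  induction N as [|N IH]; [reflexivity|].
  rewrite seq_S, sum_app, IH; unfold lsum; simpl plus; simpl map; simpl Rsum.
  rewrite Rplus_0_r.
  destruct (le_lt_dec s N), (le_lt_dec (s + len) N).
  1, 3, 4: rewrite ind_false, Rplus_0_r by lia; f_equal; lia.
  rewrite ind_true, <- S_INR by lia; f_equal; lia.
Qed.

(** * Cutting the grid into cells *)

Section Blocks.

Variables M l : nat.
Hypothesis l_gt0 : (0 < l)%nat.
Hypothesis l_le : (l <= S M)%nat.

Definition nblocks (M l : nat) : nat := (S M / l)%nat.

(* The last block absorbs the remainder, so blocks have length between [l] and [2 l]. *)
Definition block (M l x : nat) : nat := Nat.min (x / l) (nblocks M l - 1).

Lemma nblocks_spec : (0 < nblocks M l /\ nblocks M l * l <= S M < (nblocks M l + 1) * l)%nat.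
Proof.
  unfold nblocks; pose proof (Nat.div_mod_eq (S M) l);
    pose proof (Nat.mod_upper_bound (S M) l ltac:(lia)).
  assert (0 < S M / l)%nat by (apply Nat.div_str_pos; lia). nia.
Qed.

Lemma block_lt (x : nat) : (block M l x < nblocks M l)%nat.
Proof. pose proof nblocks_spec; unfold block; lia. Qed.

Lemma block_range (x i : nat) : (x <= M)%nat -> block M l x = i -> (i * l <= x < (i + 2) * l)%nat.
Proof.
  intros Hx <-; pose proof nblocks_spec; unfold block.
  pose proof (Nat.div_mod_eq x l); pose proof (Nat.mod_upper_bound x l ltac:(lia)).
  destruct (Nat.min_spec (x / l) (nblocks M l - 1)) as [[Hm ->]|[Hm ->]]; nia.
Qed.

Lemma block_eq (x i : nat) : (i < nblocks M l)%nat -> (i * l <= x < i * l + l)%nat ->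
  block M l x = i.
Proof.
  intros Hi Hx; unfold block.
  replace (x / l)%nat with i; [lia|].
  apply (Nat.div_unique x l i (x - i * l)); nia.
Qed.

Lemma block_length (i : nat) : (i < nblocks M l)%nat ->
  INR l <= lsum (fun x => ind (block M l x = i)) (seq 0 (S M)) <= 2 * INR l.
Proof.
  intros Hi; pose proof nblocks_spec as Hs; split.
  - apply Rle_trans with (lsum (fun x => ind (i * l <= x < i * l + l)%nat) (seq 0 (S M))).
    + rewrite sum_ind_interval; apply le_INR; nia.
    + apply sum_le; intros x _; apply ind_le; intros Hx; now apply block_eq.
  - apply Rle_trans with (lsum (fun x => ind (i * l <= x < i * l + 2 * l)%nat) (seq 0 (S M))).
    + apply sum_le; intros x Hx; apply in_seq in Hx; apply ind_le; intros E.
      apply block_range in E; [|lia]. nia.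
    + rewrite sum_ind_interval; change 2 with (INR 2); rewrite <- mult_INR; apply le_INR; lia.
Qed.

Definition cell_of (M l : nat) (x : pt) : pt := (block M l (fst x), block M l (snd x)).

Lemma cell_size (c : pt) : In c (cells (nblocks M l)) ->
  INR l * INR l <= lsum (fun x => ind (cell_of M l x = c)) (cells (S M)) <= 4 * (INR l * INR l).
Proof.
  destruct c as [i j]; intros Hc; apply in_cells in Hc; destruct Hc as [Hi Hj]; simpl in Hi, Hj.
  assert (E : lsum (fun x => ind (cell_of M l x = (i, j))) (cells (S M))
    = lsum (fun x => ind (block M l x = i)) (seq 0 (S M))
      * lsum (fun x => ind (block M l x = j)) (seq 0 (S M))).
  { rewrite sum_cells, Rmult_comm, <- sum_scal; apply sum_ext; intros x _.
    rewrite Rmult_comm, <- sum_scal; apply sum_ext; intros y _.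
    rewrite <- ind_and; apply ind_iff; unfold cell_of; simpl; split.
    - intros E; now inversion E.
    - intros [-> ->]; reflexivity. }
  rewrite E; clear E.
  pose proof (block_length i Hi); pose proof (block_length j Hj); pose proof (pos_INR l).
  split; nra.
Qed.

(** Two consecutive blocks span at most [3 * l] indices, so each coordinate contributes at most 9 to
    the squared distance in units of [eps * l], and [9 + 9 <= 25]. *)
Lemma near_cells_close (eps : R) (x y : pt) :
  (fst x <= M /\ snd x <= M)%nat -> (fst y <= M /\ snd y <= M)%nat -> 0 < eps ->
  near (cell_of M l x) (cell_of M l y) -> gdist eps x y <= 5 * (eps * INR l).
Proof.
  intros [Hx1 Hx2] [Hy1 Hy2] He [N1 [N2 [N3 N4]]]; simpl in *.
  pose proof (block_range _ _ Hx1 eq_refl); pose proof (block_range _ _ Hx2 eq_refl).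
  pose proof (block_range _ _ Hy1 eq_refl); pose proof (block_range _ _ Hy2 eq_refl).
  assert (D : forall u v, (u <= v + 3 * l)%nat -> (v <= u + 3 * l)%nat ->
    (eps * INR u - eps * INR v) ^ 2 <= 9 * (eps * INR l) ^ 2).
  { intros u v H3 H4; pose proof (sq_dist_le eps u v 0 (3 * l)) as H5.
    replace (9 * (eps * INR l) ^ 2) with ((eps * INR 0 - eps * INR (3 * l)) ^ 2)
      by (rewrite mult_INR; simpl; ring).
    apply H5; unfold ndist; lia. }
  assert (Hl : 0 <= eps * INR l) by (apply Rmult_le_pos; [lra|apply pos_INR]).
  unfold gdist; rewrite <- (sqrt_square (5 * (eps * INR l))) by lra.
  apply sqrt_le_1_alt.
  pose proof (D (fst x) (fst y) ltac:(nia) ltac:(nia));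
    pose proof (D (snd x) (snd y) ltac:(nia) ltac:(nia)); nra.
Qed.

End Blocks.

(** * The flooding time *)

Lemma floor_nat (q : R) : 0 <= q ->
  INR (Z.to_nat (Int_part q)) <= q < INR (Z.to_nat (Int_part q)) + 1.
Proof.
  intros Hq; destruct (base_Int_part q) as [H1 H2].
  assert (-1 < Int_part q)%Z by (apply lt_IZR; simpl; lra).
  rewrite INR_IZR_INZ, Z2Nat.id by lia; lra.
Qed.

Lemma ln_le (x y : R) : 0 < x -> x <= y -> ln x <= ln y.
Proof. intros Hx [H| ->]; [left; now apply ln_increasing|lra]. Qed.

Lemma exp_le (x y : R) : x <= y -> exp x <= exp y.
Proof. intros [H| ->]; [left; now apply exp_increasing|lra]. Qed.

Section Assembly.

Variables (n : nat) (r eps Rr : R).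
Hypothesis r_ge0 : 0 <= r.
Hypothesis eps_gt0 : 0 < eps.
Hypothesis eps_le1 : eps <= 1.
Hypothesis n_ge3 : 3 <= INR n.
Hypothesis Rr_ge : 400 * sqrt (ln (INR n)) <= Rr.
Hypothesis Rr_le : Rr <= sqrt (INR n).

Let M : nat := gridM n eps.
(** Chosen so that [5 * (eps * l) <= Rr], the distance bound of [near_cells_close]. *)
Let l : nat := Z.to_nat (Int_part (Rr / (5 * eps))).
Let m : nat := nblocks M l.
(** A quarter of the lower bound on the mean occupancy in [cell_mass]; [b] is four times the upper
    one. *)
Let a : R := Rr ^ 2 / 25600.
Let b : R := 16 * Rr ^ 2.
Let d : R := a / sqrt b.
Let occ (c : pt) (P : list pt) : R := lsum (fun x => ind (cell_of M l x = c)) P.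
(** A smooth majorant of the bad event: some summand reaches 1 as soon as an occupancy leaves the
    interval from [a] to [b]. *)
Let bad (P : list pt) : R :=
  lsum (fun c => exp (a + -1 * occ c P) + exp (- b + 1 * occ c P)) (cells m).

Lemma ln_n_ge1 : 1 <= ln (INR n).
Proof.
  rewrite <- (ln_exp 1); pose proof exp_le_3.
  apply ln_le; [apply exp_pos|lra].
Qed.

Lemma Rr_ge400 : 400 <= Rr.
Proof.
  assert (1 <= sqrt (ln (INR n))); [|lra].
  rewrite <- sqrt_1; apply sqrt_le_1_alt, ln_n_ge1.
Qed.

Lemma Rr_sq_ge : 160000 * ln (INR n) <= Rr ^ 2.
Proof.
  pose proof ln_n_ge1 as H; pose proof (sqrt_sqrt (ln (INR n)) ltac:(lra)).
  pose proof (sqrt_pos (ln (INR n))); nra.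
Qed.

Lemma sqrt_n_sq : sqrt (INR n) * sqrt (INR n) = INR n.
Proof. apply sqrt_sqrt; lra. Qed.

Lemma cell_side : Rr / 10 <= eps * INR l <= Rr / 5.
Proof.
  pose proof Rr_ge400.
  (* The quotient is large, so rounding it down loses less than half. *)
  assert (Hq : 80 <= Rr / (5 * eps)).
  { apply Rmult_le_reg_r with (5 * eps); [lra|].
    unfold Rdiv; rewrite Rmult_assoc, Rinv_l; lra. }
  destruct (floor_nat (Rr / (5 * eps))) as [H1 H2]; [lra|]; fold l in H1, H2.
  assert (E : eps * (Rr / (5 * eps)) = Rr / 5) by (field; lra).
  split; nra.
Qed.

Lemma grid_side : sqrt (INR n) <= eps * INR (S M) <= 2 * sqrt (INR n).
Proof.
  pose proof Rr_ge400.
  assert (0 <= sqrt (INR n) / eps) by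
    (apply Rmult_le_pos; [apply sqrt_pos|left; now apply Rinv_0_lt_compat]).
  destruct (floor_nat (sqrt (INR n) / eps)) as [H1 H2]; trivial.
  fold (gridM n eps) in H1, H2; fold M in H1, H2.
  assert (E : eps * (sqrt (INR n) / eps) = sqrt (INR n)) by (field; lra).
  rewrite S_INR; split; nra.
Qed.

Lemma l_bounds : (0 < l /\ l <= S M)%nat.
Proof.
  pose proof cell_side; pose proof grid_side; pose proof Rr_ge400.
  split.
  - apply INR_lt; simpl; nra.
  - apply INR_le. nra.
Qed.

(** A cell has side at least 40 and the grid side is at most [2 * sqrt n], so the union bound over
    cells costs at most a factor [n]. *)
Lemma nblocks_sq_le : INR (length (cells m)) <= INR n.
Proof.
  rewrite length_cells, mult_INR, <- sqrt_n_sq.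
  destruct l_bounds as [Hl Hl'].
  destruct (nblocks_spec M l Hl Hl') as [_ [H _]]; fold m in H.
  apply le_INR in H; rewrite mult_INR in H.
  pose proof cell_side; pose proof grid_side; pose proof Rr_ge400.
  pose proof (pos_INR m).
  assert (INR m * (eps * INR l) <= eps * INR (S M)) by nra.
  assert (INR m * 40 <= 2 * sqrt (INR n)) by nra.
  apply Rmult_le_compat; trivial; lra.
Qed.

(** In units of length, the cell side [X] lies between [Rr / 10] and [Rr / 5], the cell has area
    between [X ^ 2] and [4 * X ^ 2], and the grid has area between [n] and [4 * n]. With the factor
    16 of [pi_weight_bounds], the constants are [100 * 16 * 4 = 6400] and [16 * 4 / 25 <= 4]. *)
Lemma cell_mass (c : pt) : In c (cells m) ->
  Rr ^ 2 / 6400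
  <= INR n * lsum (fun wx => fst wx * ind (cell_of M l (snd wx) = c)) (pi_dist n eps r)
  <= 4 * Rr ^ 2.
Proof.
  intros Hc; destruct l_bounds as [Hl Hl'].
  destruct (pi_weight_bounds n eps r (fun x => cell_of M l x = c) r_ge0) as [H1 H2].
  pose proof (cell_size M l Hl Hl' c Hc) as Hp.
  change (cells (S M)) with (grid n eps) in Hp.
  set (p := lsum (fun x => ind (cell_of M l x = c)) (grid n eps)) in *.
  set (q := lsum _ (pi_dist n eps r)) in *.
  assert (HN : INR (length (grid n eps)) = INR (S M) * INR (S M)).
  { rewrite <- mult_INR, <- length_cells; reflexivity. }
  rewrite HN in H1, H2.
  pose proof cell_side as HX; pose proof grid_side as HY; pose proof Rr_ge400 as HR.
  pose proof sqrt_n_sq as Hn.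
  assert (HS : 0 < INR (S M)) by (apply lt_0_INR; lia).
  set (X := eps * INR l) in *; set (Y := eps * INR (S M)) in *.
  assert (HY2 : INR n <= Y * Y <= 4 * INR n) by nra.
  assert (He : 0 < eps * eps) by nra.
  assert (Hp' : X * X <= eps * eps * p <= 4 * (X * X)) by (unfold X; split; nra).
  assert (H1' : eps * eps * p <= 16 * (Y * Y) * q).
  { replace (eps * eps * p) with (16 * (Y * Y) * (p / (16 * (INR (S M) * INR (S M)))))
      by (unfold Y; field; lra).
    apply Rmult_le_compat_l; nra. }
  assert (H2' : Y * Y * q <= 16 * (eps * eps * p)).
  { replace (16 * (eps * eps * p)) with (Y * Y * (16 * p / (INR (S M) * INR (S M))))
      by (unfold Y; field; lra).
    apply Rmult_le_compat_l; nra. }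
  assert (Hq : 0 <= q).
  { apply Rmult_le_reg_l with (16 * (Y * Y)); nra. }
  split; nra.
Qed.

Lemma expected_bad :
  Eprod (repeat (pi_dist n eps r) n) bad <= INR n * (2 * exp (- 4 * ln (INR n))).
Proof.
  unfold bad; rewrite Eprod_sum.
  apply Rle_trans with (lsum (fun _ => 2 * exp (- 4 * ln (INR n))) (cells m)).
  2:{ rewrite sum_const; apply Rmult_le_compat_r; [|apply nblocks_sq_le].
      pose proof (exp_pos (- 4 * ln (INR n))); lra. }
  apply sum_le; intros c Hc; rewrite Eprod_plus.
  pose proof (occupancy_mgf _ (fun x => cell_of M l x = c) a (-1) n (is_prob_pi n r eps r_ge0)) as H1.
  pose proof (occupancy_mgf _ (fun x => cell_of M l x = c) (- b) 1 n (is_prob_pi n r eps r_ge0)) as H2.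
  pose proof (cell_mass c Hc) as Hq.
  set (q := lsum _ (pi_dist n eps r)) in *.
  pose proof Rr_sq_ge as HR; pose proof ln_n_ge1 as Hln.
  pose proof exp_le_3 as He3; pose proof (exp_ineq1_le 1) as He2.
  assert (He : exp (-1) <= 1 / 2).
  { assert (exp (-1) * exp 1 = 1)
      by (rewrite <- exp_plus; replace (-1 + 1) with 0 by lra; apply exp_0).
    pose proof (exp_pos (-1)); nra. }
  (* The exponent is at most [Rr ^ 2 / 25600 - Rr ^ 2 / 12800], hence at most [- 6.25 * ln n] by
     [Rr_sq_ge]; this is where the constant 400 enters. *)
  assert (E1 : exp (a + INR n * ((exp (-1) - 1) * q)) <= exp (- 4 * ln (INR n))).
  { apply exp_le; unfold a.
    replace (INR n * ((exp (-1) - 1) * q)) with ((exp (-1) - 1) * (INR n * q)) by ring. nra. }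
  (* Since [exp 1 - 1 <= 2], the exponent is at most [- 16 * Rr ^ 2 + 8 * Rr ^ 2]. *)
  assert (E2 : exp (- b + INR n * ((exp 1 - 1) * q)) <= exp (- 4 * ln (INR n))).
  { apply exp_le; unfold b.
    replace (INR n * ((exp 1 - 1) * q)) with ((exp 1 - 1) * (INR n * q)) by ring. nra. }
  unfold occ; lra.
Qed.

Lemma bad_ge0 (P : list pt) : 0 <= bad P.
Proof.
  apply sum_nonneg; intros c _; apply Rplus_le_le_0_compat; left; apply exp_pos.
Qed.

Lemma not_bad_occupancy (P : list pt) (c : pt) :
  bad P < 1 -> In c (cells m) -> a <= occ c P <= b.
Proof.
  intros Hb Hc.
  assert (H : exp (a + -1 * occ c P) + exp (- b + 1 * occ c P) <= bad P).
  { apply (sum_ge_term (fun c => exp (a + -1 * occ c P) + exp (- b + 1 * occ c P))); trivial.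
    intros; apply Rplus_le_le_0_compat; left; apply exp_pos. }
  pose proof (exp_pos (a + -1 * occ c P)); pose proof (exp_pos (- b + 1 * occ c P)).
  pose proof (exp_ineq1_le (a + -1 * occ c P)); pose proof (exp_ineq1_le (- b + 1 * occ c P)).
  lra.
Qed.

(** Three phases: steady gain, fewer than [a] nodes left, done. The second phase lasts one round and
    allows for one round without gain, hence [t - 1]; it keeps a potential bound so that it too is
    excluded at the final time. *)
Definition flood_level (t : nat) (I : nat -> nat -> bool) : Prop :=
  forall s, (s < n)%nat ->
  let J := fun j => I s j = true in
  J s /\
  (- sqrt (INR n) + INR t * (d / 3) <= potential n J \/
   (uninformed n J < a /\ - sqrt (INR n) + (INR t - 1) * (d / 3) <= potential n J) \/
   uninformed n J = 0).

Lemma a_gt0 : 0 < a.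
Proof. pose proof Rr_ge400; unfold a; nra. Qed.

Lemma d_eq : d = Rr / 102400.
Proof.
  pose proof Rr_ge400; unfold d, a, b.
  replace (16 * Rr ^ 2) with ((4 * Rr) * (4 * Rr)) by ring.
  rewrite sqrt_square by lra; field; lra.
Qed.

Lemma flood_level_init : flood_level 0 Nat.eqb.
Proof.
  intros s Hs; simpl; split; [apply Nat.eqb_refl|left].
  set (J := fun j => (s =? j)%nat = true); unfold potential.
  assert (uninformed n J <= INR n).
  { pose proof (informed_plus_uninformed n J).
    assert (0 <= informed n J) by (apply sum_nonneg; intros; apply ind_bounds). lra. }
  assert (sqrt (uninformed n J) <= sqrt (INR n)) by now apply sqrt_le_1_alt.
  pose proof (sqrt_pos (informed n J)); lra.
Qed.

Lemma flood_level_step (t : nat) I P :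
  on_grid n eps P -> bad P < 1 -> flood_level t I ->
  flood_level (S t) (flood_step n Rr eps P I).
Proof.
  intros [Hlen HP] Hbad Hlev s Hs J'.
  destruct (Hlev s Hs) as [HJs HJ]; set (J := fun j => I s j = true) in *.
  pose (cell := fun i => cell_of M l (nth i P (0, 0)%nat)).
  pose (adj := fun i j => adjb Rr eps P i j = true).
  destruct l_bounds as [Hl Hl']; pose proof Rr_ge400 as HR; pose proof a_gt0 as Ha.
  assert (Hab : a <= b) by (unfold a, b; nra).
  assert (Hcell : forall i, (i < n)%nat -> In (cell i) (cells m)).
  { intros i _; apply in_cells; split; apply block_lt; trivial. }
  assert (Hnear : forall i j, (i < n)%nat -> (j < n)%nat -> near (cell i) (cell j) -> adj i j).
  { intros i j Hi Hj Hn; apply Rleb_true.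
    rewrite Forall_forall in HP.
    eapply Rle_trans; [apply (near_cells_close M l Hl Hl'); trivial|].
    - apply in_grid, HP, nth_In; lia.
    - apply in_grid, HP, nth_In; lia.
    - pose proof cell_side; lra. }
  assert (Hocc : forall c, In c (cells m) ->
    a <= lsum (fun i => ind (cell i = c)) (seq 0 n) <= b).
  { intros c Hc.
    pose proof (sum_seq_nth (fun x => ind (cell_of M l x = c)) P (0, 0)%nat) as E.
    rewrite Hlen in E; fold (occ c P) in E; unfold cell; rewrite E.
    now apply not_bad_occupancy. }
  assert (Hincr : forall i, J i -> J' i).
  { intros i Hi; unfold J', flood_step; unfold J in Hi; now rewrite Hi. }
  assert (Hadj : forall i j, (i < n)%nat -> (j < n)%nat -> J i -> adj i j -> J' j).
  { intros i j Hi Hj HJi Hij; unfold J', flood_step; apply Bool.orb_true_iff; right.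
    apply existsb_exists; exists i; split; [apply in_seq; lia|].
    now apply andb_true_intro. }
  split; [now apply Hincr|].
  pose proof (potential_round_mono n J J' Hincr) as Hmono.
  pose proof (flooding_completes n m cell adj a b Hcell Hnear Hocc J J' Hadj) as Hdone.
  rewrite S_INR; destruct HJ as [HJ|[[HJ _]|HJ]].
  - destruct (potential_step n m cell adj a b Ha Hab Hcell Hnear Hocc J J' Hincr Hadj s Hs HJs)
      as [H|H]; fold d in H.
    + left; lra.
    + right; left; split; trivial; lra.
  - right; right; auto.
  - right; right; apply Hdone; lra.
Qed.

Lemma flood_level_final (K : nat) I :
  2 * sqrt (INR n) < (INR K - 1) * (d / 3) -> flood_level K I -> all_informed n I = true.
Proof.
  intros HK Hlev; apply forallb_forall; intros s Hs; apply forallb_forall; intros j Hj.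
  apply in_seq in Hs; destruct (Hlev s ltac:(lia)) as [_ H].
  set (J := fun j => I s j = true) in *.
  assert (Hd : 0 < d) by (rewrite d_eq; pose proof Rr_ge400; lra).
  assert (potential n J <= sqrt (INR n)).
  { pose proof (informed_plus_uninformed n J).
    assert (0 <= uninformed n J) by (apply sum_nonneg; intros; apply ind_bounds).
    assert (sqrt (informed n J) <= sqrt (INR n)) by (apply sqrt_le_1_alt; lra).
    pose proof (sqrt_pos (uninformed n J)); unfold potential; lra. }
  (* The first two alternatives would push the potential above its maximum [sqrt n]. *)
  assert (Hu : uninformed n J = 0).
  { destruct H as [H|[[_ H]|H]]; trivial; exfalso; nra. }
  apply NNPP; intros HJ.
  assert (ind (~ J j) <= uninformed n J).
  { apply (sum_ge_term (fun j => ind (~ J j))); trivial. intros; apply ind_bounds. }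
  rewrite ind_true in * by exact HJ; lra.
Qed.

Lemma flood_prob_lower (K : nat) :
  2 * sqrt (INR n) < (INR K - 1) * (Rr / 307200) ->
  1 - INR K * (INR n * (2 * exp (- 4 * ln (INR n)))) <= flood_prob n r Rr eps K.
Proof.
  intros HK.
  eapply Rle_trans; [|apply (flood_prob_ge n r eps r_ge0 Rr bad bad_ge0 flood_level K)].
  - pose proof expected_bad; pose proof (pos_INR K); nra.
  - apply flood_level_init.
  - apply flood_level_step.
  - intros I; apply flood_level_final; rewrite d_eq; lra.
Qed.

End Assembly.

Theorem mainTheorem8 :
  exists c C : R, 0 < c /\ 0 < C /\
  exists n0 : nat, forall n : nat, (n0 <= n)%nat ->
  forall r eps Rr : R,
    0 <= r -> 0 < eps -> eps <= 1 -> eps < Rr ->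
    c * sqrt (ln (INR n)) <= Rr -> Rr <= sqrt (INR n) ->
    flood_prob n r Rr eps
      (Z.to_nat (Int_part (C * (sqrt (INR n) / Rr + ln (ln Rr)))))
    >= 1 - 1 / INR n.
Proof.
  (* The value of [C] must exceed [2 * 307200] with room for rounding and for the extra round, so
     that the potential crosses its whole range of length [2 * sqrt n]. *)
  exists 400, 1000000; split; [lra|]; split; [lra|].
  (* The failure probability is at most [2 * K / n ^ 3] with [K <= 2000000 * n], and
     [4000000 / n ^ 2 <= 1 / n] from this threshold on. *)
  exists (Z.to_nat 4000000); intros n Hn r eps Rr Hr He He1 _ HR HRn.
  assert (Hn4 : 4000000 <= INR n) by (rewrite INR_IZR_INZ; apply IZR_le; lia).
  assert (HR400 : 400 <= Rr) by (apply (Rr_ge400 n Rr); trivial; lra).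
  assert (Hln : 1 <= ln Rr).
  { rewrite <- (ln_exp 1); pose proof exp_le_3; apply ln_le; [apply exp_pos|lra]. }
  assert (Hlnln : 0 <= ln (ln Rr)) by (rewrite <- ln_1; apply ln_le; lra).
  assert (ln_le_id : forall x, 0 < x -> ln x <= x).
  { intros x Hx; pose proof (exp_ineq1_le (ln x)) as H; rewrite exp_ln in H; lra. }
  assert (Hsn : sqrt (INR n) * sqrt (INR n) = INR n) by (apply sqrt_sqrt; lra).
  assert (Hq1 : sqrt (INR n) / Rr * Rr = sqrt (INR n)) by (field; lra).
  assert (Hq : 1 <= sqrt (INR n) / Rr <= sqrt (INR n)) by (split; nra).
  set (q := sqrt (INR n) / Rr) in *.
  destruct (floor_nat (1000000 * (q + ln (ln Rr)))) as [HK1 HK2]; [nra|].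
  set (K := Z.to_nat (Int_part _)) in *.
  assert (ln (ln Rr) <= sqrt (INR n)).
  { pose proof (ln_le_id Rr ltac:(lra)); pose proof (ln_le_id (ln Rr) ltac:(lra)); lra. }
  assert (HKn : INR K <= 2000000 * INR n) by nra.
  apply Rle_ge.
  eapply Rle_trans; [|apply (flood_prob_lower n r eps Rr); trivial; try lra].
  - assert (E : exp (- 4 * ln (INR n)) = / INR n * / INR n * / INR n * / INR n).
    { replace (- 4 * ln (INR n)) with (- ln (INR n) + - ln (INR n) + - ln (INR n) + - ln (INR n))
        by ring.
      rewrite !exp_plus, exp_Ropp, exp_ln by lra; reflexivity. }
    rewrite E.
    replace (INR n * (2 * (/ INR n * / INR n * / INR n * / INR n)))
      with (2 * (/ INR n * / INR n * / INR n)) by (field; lra).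
    set (i := / INR n) in *.
    assert (Hi : INR n * i = 1) by (unfold i; field; lra).
    assert (Hi0 : 0 < i) by (apply Rinv_0_lt_compat; lra).
    assert (INR K * i <= 2000000).
    { replace 2000000 with (2000000 * INR n * i) by (rewrite Rmult_assoc, Hi; ring).
      apply Rmult_le_compat_r; lra. }
    assert (4000000 * i <= 1) by nra.
    replace (1 / INR n) with i by (unfold i; field; lra).
    replace (INR K * (2 * (i * i * i))) with (2 * (INR K * i) * (i * i)) by ring.
    nra.
  - nra.
Qed.
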